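(* There is a partial computable function $f:\subseteq\omega^\omega\to\omega_1$ such that, if $x\in\omega^\omega$ codes an open set $A\subseteq\omega^\omega$ for which there is a Laver tree $T$ with $[T]\subseteq A$, then $x\in\mathrm{dom}(f)$ and there is a Laver tree $T'\leq_{\mathrm T}x^{(f(x))}$ with $[T']\subseteq A$.
   Context: A tree is a prefix-closed subset of $\omega^{<\omega}$, with body $[T]=\{g\in\omega^\omega:\forall n\ g\upharpoonright n\in T\}$. A Laver tree (always with empty stem) is a tree $T$ with $\langle\rangle\in T$ such that every $\sigma\in T$ has infinitely many immediate successors in $T$. Fix a standard effective bijection $i:\omega\to\omega^{<\omega}$. An $x\in\omega^\omega$ codes the open set of all $g\in\omega^\omega$ that have a prefix in $\{i(k):\exists n\ x(n)=k+1\}$. Countable ordinals are represented by (characteristic functions of) wellorders with domain a subset of $\omega$ of the corresponding order type, so that a partial computable function $f:\subseteq\omega^\omega\to\omega_1$ is induced by a partial computable function sending each $x\in\mathrm{dom}(f)$ to a wellorder of type $f(x)$; in particular $f(x)$ is an $x$-computable ordinal. For an $x$-computable ordinal $\beta$, $x^{(\beta)}$ is the $\beta$-th iterate of the Turing jump applied to $x$. *)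

(* Defs.v *)
From Stdlib Require Import Arith Lia List Cantor Wf_nat.
From Stdlib Require Import ClassicalEpsilon FunctionalExtensionality.
Import ListNotations.

Definition baire : Type := nat -> nat.

(** * Finite sequences, trees and open sets *)

(* The bijection i : omega -> omega^{<omega}:
   i(0) = <> and i(<a, b> + 1) = a :: i(b), with <_, _> Cantor's pairing.
   The first argument of [decode_fuel] only bounds the recursion depth. *)
Fixpoint decode_fuel (fuel n : nat) : list nat :=
  match fuel, n with
  | S fuel', S k => let (a, b) := Cantor.of_nat k in a :: decode_fuel fuel' b
  | _, _ => []
  end.

Definition decode_seq (n : nat) : list nat := decode_fuel n n.

Fixpoint encode_seq (s : list nat) : nat :=
  match s with
  | [] => 0
  | a :: s' => S (Cantor.to_nat (a, encode_seq s'))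
  end.

Lemma decode_encode_seq (s : list nat) : decode_seq (encode_seq s) = s.
Proof.
  unfold decode_seq.
  enough (H : forall fuel, encode_seq s <= fuel ->
                           decode_fuel fuel (encode_seq s) = s)
    by (apply H; lia).
  induction s as [|a s IH]; intros fuel Hf; [now destruct fuel|].
  cbn [encode_seq] in *; destruct fuel as [|fuel]; [lia|].
  cbn [decode_fuel]; rewrite Cantor.cancel_of_to; f_equal; apply IH.
  pose proof (Cantor.to_nat_non_decreasing a (encode_seq s)); lia.
Qed.

Lemma encode_decode_seq (n : nat) : encode_seq (decode_seq n) = n.
Proof.
  unfold decode_seq.
  enough (H : forall fuel k, k <= fuel -> encode_seq (decode_fuel fuel k) = k)
    by (apply H; lia).
  induction fuel as [|fuel IH]; intros k Hk.
  - now replace k with 0 by lia.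
  - destruct k as [|k]; [reflexivity|].
    cbn [decode_fuel]; destruct (Cantor.of_nat k) as [a b] eqn:E.
    assert (Ek : Cantor.to_nat (a, b) = k)
      by (rewrite <- E; apply Cantor.cancel_to_of).
    pose proof (Cantor.to_nat_non_decreasing a b).
    cbn [encode_seq]; rewrite IH by lia; now rewrite Ek.
Qed.

Definition restrict (g : baire) (n : nat) : list nat := map g (seq 0 n).

Definition prefix_of (s : list nat) (g : baire) : Prop :=
  exists n, s = restrict g n.

Definition coded_open (x : baire) (g : baire) : Prop :=
  exists n k, x n = S k /\ prefix_of (decode_seq k) g.

Definition is_tree (T : list nat -> Prop) : Prop :=
  forall s t, T (s ++ t) -> T s.

Definition body (T : list nat -> Prop) (g : baire) : Prop :=
  forall n, T (restrict g n).

Definition laver_tree (T : list nat -> Prop) : Prop :=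
  is_tree T /\ T [] /\
  forall s, T s -> forall b, exists k, b <= k /\ T (s ++ [k]).

(** * Oracle computability *)

(* Programs for the functions on nat that are partial recursive relative to an
   oracle; several arguments are passed as one number by Cantor's pairing. *)
Inductive prog : Type :=
| pZero | pSucc | pLeft | pRight | pOracle
| pPair (p q : prog)
| pComp (p q : prog)
| pRec (p q : prog)
| pMu (p : prog).

(* [eval x p n v] : run on input n with oracle x, p halts with output v. *)
Inductive eval (x : baire) : prog -> nat -> nat -> Prop :=
| eval_zero n : eval x pZero n 0
| eval_succ n : eval x pSucc n (S n)
| eval_left a b : eval x pLeft (Cantor.to_nat (a, b)) a
| eval_right a b : eval x pRight (Cantor.to_nat (a, b)) b
| eval_oracle n : eval x pOracle n (x n)
| eval_pair p q n u v :
    eval x p n u -> eval x q n v ->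
    eval x (pPair p q) n (Cantor.to_nat (u, v))
| eval_comp p q n u v :
    eval x q n u -> eval x p u v -> eval x (pComp p q) n v
| eval_rec_0 p q a v :
    eval x p a v -> eval x (pRec p q) (Cantor.to_nat (a, 0)) v
| eval_rec_S p q a k u v :
    eval x (pRec p q) (Cantor.to_nat (a, k)) u ->
    eval x q (Cantor.to_nat (a, Cantor.to_nat (k, u))) v ->
    eval x (pRec p q) (Cantor.to_nat (a, S k)) v
| eval_mu p a k (u : nat -> nat) :
    (forall j, j < k -> eval x p (Cantor.to_nat (a, j)) (S (u j))) ->
    eval x p (Cantor.to_nat (a, k)) 0 ->
    eval x (pMu p) a k.

(* A bijective Goedel numbering of the programs. *)
Fixpoint prog_index (p : prog) : nat :=
  match p with
  | pZero => 0
  | pSucc => 1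
  | pLeft => 2
  | pRight => 3
  | pOracle => 4
  | pPair p q => 5 + 4 * Cantor.to_nat (prog_index p, prog_index q)
  | pComp p q => 6 + 4 * Cantor.to_nat (prog_index p, prog_index q)
  | pRec p q => 7 + 4 * Cantor.to_nat (prog_index p, prog_index q)
  | pMu p => 8 + 4 * prog_index p
  end.

Definition computes (x : baire) (p : prog) (y : baire) : Prop :=
  forall n, eval x p n (y n).

Definition turing_le (y x : baire) : Prop := exists p, computes x p y.

Definition char_fun (A : nat -> Prop) : baire :=
  fun n => if excluded_middle_informative (A n) then 1 else 0.

Definition tree_char (T : list nat -> Prop) : baire :=
  char_fun (fun k => T (decode_seq k)).

Definition jump (x : baire) : baire :=
  char_fun (fun e => exists p, prog_index p = e /\ exists v, eval x p e v).

(** * Wellorders on subsets of omega and countable ordinals *)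

(* A relation on omega is given by the characteristic function r of its set of
   pairs.  The order is the reflexive one, so that its field is determined by r
   (a strict order cannot distinguish the order types 0 and 1). *)
Definition rle (r : baire) (m n : nat) : Prop := r (Cantor.to_nat (m, n)) = 1.
Definition rdom (r : baire) (n : nat) : Prop := rle r n n.
Definition rlt (r : baire) (m n : nat) : Prop := rle r m n /\ m <> n.

Record is_wellorder (r : baire) : Prop := {
  wo_01 : forall k, r k = 0 \/ r k = 1;
  wo_dom : forall m n, rle r m n -> rdom r m /\ rdom r n;
  wo_antisym : forall m n, rle r m n -> rle r n m -> m = n;
  wo_trans : forall l m n, rle r l m -> rle r m n -> rle r l n;
  wo_total : forall m n, rdom r m -> rdom r n -> rle r m n \/ rle r n m;
  wo_wf : well_founded (rlt r)
}.

Record wellorder : Type := {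
  wo_char :> baire;
  wo_axioms : is_wellorder wo_char
}.

Definition same_type (r s : baire) : Prop :=
  exists h : nat -> nat,
    (forall n, rdom r n -> rdom s (h n)) /\
    (forall m, rdom s m -> exists n, rdom r n /\ h n = m) /\
    (forall m n, rdom r m -> rdom r n -> (rle r m n <-> rle s (h m) (h n))).

(* The countable ordinals, as the isomorphism classes of these wellorders. *)
Definition omega1 : Type :=
  { C : wellorder -> Prop | exists w, forall v, C v <-> same_type w v }.

Definition has_type (w : wellorder) (b : omega1) : Prop := proj1_sig b w.

(* [f x = None] means that x is outside dom(f).  The program may also halt on
   oracles outside dom(f); nothing is required of it there. *)
Definition partial_computable (f : baire -> option omega1) : Prop :=
  exists p : prog, forall x b, f x = Some b ->
    exists w : wellorder, computes x p w /\ has_type w b.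

(** * Transfinite iteration of the jump *)

Definition join (x y : baire) : baire :=
  fun n => if Nat.even n then x (Nat.div2 n) else y (Nat.div2 n).

Definition rlt_dec (r : baire) (m n : nat) : {rlt r m n} + {~ rlt r m n}.
Proof.
  unfold rlt, rle.
  destruct (Nat.eq_dec (r (Cantor.to_nat (m, n))) 1), (Nat.eq_dec m n);
    solve [left; tauto | right; tauto].
Defined.

(* The jump hierarchy on x along w: column n is
   H_n = jump (x (+) { <m, k> : m <_w n, k in H_m }). *)
Definition jump_column (x : baire) (w : wellorder) : nat -> baire :=
  Fix (wo_wf w (wo_axioms w)) (fun _ => baire)
    (fun n H =>
       jump (join x (fun j =>
         let (m, k) := Cantor.of_nat j in
         match rlt_dec w m n with
         | left h => H m h k
         | right _ => 0
         end))).

Definition iter_jump (x : baire) (w : wellorder) : baire :=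
  join x (fun j =>
    let (m, k) := Cantor.of_nat j in
    if Nat.eq_dec (wo_char w (Cantor.to_nat (m, m))) 1 then jump_column x w m k else 0).

Lemma jump_column_unfold (x : baire) (w : wellorder) (n : nat) :
  jump_column x w n =
  jump (join x (fun j =>
    let (m, k) := Cantor.of_nat j in
    if rlt_dec w m n then jump_column x w m k else 0)).
Proof.
  unfold jump_column at 1; rewrite Fix_eq; [reflexivity|].
  intros m H H' E; f_equal; f_equal; apply functional_extensionality; intro j.
  destruct (Cantor.of_nat j) as [l k]; destruct (rlt_dec w l m); [|reflexivity].
  now rewrite E.
Qed.

(* y <=_T x^(b) for an x-computable ordinal b.  The degree of [iter_jump x w] is
   the same for all x-computable wellorders w of type b (Spector); the definition
   refers to all of them, and requires that there is one. *)
Definition turing_le_iter_jump (y x : baire) (b : omega1) : Prop :=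
  (exists w : wellorder, has_type w b /\ turing_le w x) /\
  forall w : wellorder, has_type w b -> turing_le w x ->
    turing_le y (iter_jump x w).

(* Main.v *)
From Stdlib Require Import Arith Lia List Cantor Bool Wf_nat Wellfounded.
From Stdlib Require Import ClassicalEpsilon FunctionalExtensionality PropExtensionality.
Require Import Defs.
Import ListNotations.

(** Call a node covered if it has a prefix in the list X that x enumerates, and
    good if it is covered or infinitely many of its successors are good (an
    inductive definition).  Every good node has an ordinal rank, and if the root
    is good then the nodes that are reached from it by letting the rank drop at
    each step, until a covered node is met, form a Laver tree whose branches all
    lie in the open set A coded by x.  Two things remain: x has to compute, by one
    program, a wellorder that bounds the rank of the root, and the ranks have to
    be computable from the jump hierarchy along that wellorder.

    The bound.  The root fails to be good exactly when some function b from nodes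
    to omega is such that no element s of X satisfies b(p) <= a for all prefixes
    p ++ [a] of s: then b witnesses at every bad node that almost all successors
    are bad.  Finite approximations to such a b that have not yet been refuted by
    X form an x-computable tree of [attempt]s.  An infinite branch of it is a
    function b as above, and a Laver tree T with [T] included in A would have a
    branch above b, which meets X; so the tree is wellfounded ([attempts_acc]) and
    its Kleene-Brouwer order is a wellorder ([attempt_order_wellorder]).  The
    function f sends x to the type of this order.  By induction along the order,
    for every attempt u some node obeys the bounds in u and is good, with rank at
    most the position of u ([attempt_secured]); for u = [] that node is the root.

    The jumps.  To be good at stage n is a Pi_2 condition on the earlier stages,
    whereas a column of the hierarchy is only one jump above the previous columns.
    The ranks are therefore slowed down: s is secured at n if it is covered or if,
    for some m < l < n, infinitely many successors of s are secured below m; here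
    column m decides each question whether a large enough successor is secured
    below m, column l decides whether all these answers are positive, and column n
    searches for l and m ([secures], [secured_queries]).  A program run by the
    jump on its own index can read that index, which makes this recursion along
    the hierarchy possible without a fixed point theorem ([self_query_spec]).

    Independence of the notation.  The iterated jump has to be taken along every
    x-computable wellorder w of type f(x), and the isomorphism with the
    Kleene-Brouwer order need not be computable from x.  But the
    securing stages are defined from the order alone, so an isomorphism carries
    them over ([secures_iso]), and the tree of rank descents is the same for all
    these w ([descent_tree_iso]).  It is computable from the hierarchy along each
    of them ([descent_tree_computable]). *)

(** * Computable functionals *)

Local Notation "⟨ a , b ⟩" := (Cantor.to_nat (a, b)) (at level 0, a at level 99, b at level 99).
Local Notation π1 n := (fst (Cantor.of_nat n)).
Local Notation π2 n := (snd (Cantor.of_nat n)).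

Lemma pi1_pair a b : π1 ⟨a, b⟩ = a.
Proof. now rewrite Cantor.cancel_of_to. Qed.

Lemma pi2_pair a b : π2 ⟨a, b⟩ = b.
Proof. now rewrite Cantor.cancel_of_to. Qed.

Lemma pair_eta n : ⟨π1 n, π2 n⟩ = n.
Proof. rewrite <- surjective_pairing; apply Cantor.cancel_to_of. Qed.

Lemma pair_inj a b c d : ⟨a, b⟩ = ⟨c, d⟩ -> a = c /\ b = d.
Proof. intro E; apply Cantor.to_nat_inj in E; now inversion E. Qed.

(** The functional F is computed by a single program on all oracles in the class C.
    A class with one element gives computability relative to a fixed oracle, and
    there a search has to terminate for that oracle only. *)
Definition computable (C : baire -> Prop) (F : baire -> nat -> nat) : Prop :=
  exists p, forall x, C x -> forall n, eval x p n (F x n).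

Definition computableb C (F : baire -> nat -> bool) : Prop :=
  computable C (fun x n => Nat.b2n (F x n)).

Definition computablel C (F : baire -> nat -> list nat) : Prop :=
  computable C (fun x n => encode_seq (F x n)).

Lemma computable_ext C F G :
  computable C F -> (forall x n, C x -> F x n = G x n) -> computable C G.
Proof.
  intros [p Hp] E; exists p; intros x Cx n; rewrite <- E by exact Cx.
  now apply Hp.
Qed.

Lemma computable_arg C : computable C (fun _ n => n).
Proof.
  exists (pPair pLeft pRight); intros x _ n.
  rewrite <- (pair_eta n); constructor; constructor.
Qed.

Lemma computable_const C c : computable C (fun _ _ => c).
Proof.
  induction c as [|c [p Hp]].
  - exists pZero; constructor.
  - exists (pComp pSucc p); intros x Cx n.
    econstructor; [now apply Hp | constructor].
Qed.

Lemma computable_subst C F G :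
  computable C F -> computable C G -> computable C (fun x n => F x (G x n)).
Proof.
  intros [p Hp] [q Hq]; exists (pComp p q); intros x Cx n.
  econstructor; [now apply Hq | now apply Hp].
Qed.

Lemma computable_succ C F :
  computable C F -> computable C (fun x n => S (F x n)).
Proof.
  apply (computable_subst C (fun _ n => S n)); exists pSucc; constructor.
Qed.

Lemma computable_oracle C F :
  computable C F -> computable C (fun x n => x (F x n)).
Proof.
  apply (computable_subst C (fun x n => x n)); exists pOracle; constructor.
Qed.

Lemma computable_pi1 C F : computable C F -> computable C (fun x n => π1 (F x n)).
Proof.
  apply (computable_subst C (fun _ n => π1 n)); exists pLeft; intros x _ n.
  rewrite <- (pair_eta n) at 1; constructor.
Qed.

Lemma computable_pi2 C F : computable C F -> computable C (fun x n => π2 (F x n)).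
Proof.
  apply (computable_subst C (fun _ n => π2 n)); exists pRight; intros x _ n.
  rewrite <- (pair_eta n) at 1; constructor.
Qed.

Lemma computable_pair C F G :
  computable C F -> computable C G -> computable C (fun x n => ⟨F x n, G x n⟩).
Proof.
  intros [p Hp] [q Hq]; exists (pPair p q); intros x Cx n.
  constructor; [now apply Hp | now apply Hq].
Qed.

(** The step takes its parameter, the counter and the accumulator in the order in
    which [pRec] passes them. *)
Lemma computable_nat_rect C B N St :
  computable C B -> computable C N ->
  computable C (fun x m => St x (π1 m) (π1 (π2 m)) (π2 (π2 m))) ->
  computable C (fun x n => nat_rect (fun _ => nat) (B x n) (St x n) (N x n)).
Proof.
  intros [p Hp] HN [q Hq].
  refine (computable_ext _ _ _ (computable_subst C
    (fun x m => nat_rect (fun _ => nat) (B x (π1 m)) (St x (π1 m)) (π2 m))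
    _ _ (computable_pair _ _ _ (computable_arg C) HN)) _).
  2: now intros; rewrite pi1_pair, pi2_pair.
  exists (pRec p q); intros x Cx m.
  rewrite <- (pair_eta m) at 1; generalize (π1 m) as a, (π2 m) as k; clear m.
  intros a k; induction k as [|k IH]; cbn [nat_rect].
  - constructor; now apply Hp.
  - econstructor; [exact IH|].
    set (r := nat_rect _ _ _ _); specialize (Hq x Cx ⟨a, ⟨k, r⟩⟩).
    now rewrite pi1_pair, !pi2_pair, pi1_pair in Hq.
Qed.

Lemma computable_pred C F : computable C F -> computable C (fun x n => pred (F x n)).
Proof.
  intro HF; refine (computable_ext _ _ _
    (computable_nat_rect C (fun _ _ => 0) F (fun _ _ k _ => k) _ HF _) _).
  - apply computable_const.
  - now apply computable_pi1, computable_pi2, computable_arg.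
  - intros x n _; now destruct (F x n).
Qed.

Lemma computable_add C F G :
  computable C F -> computable C G -> computable C (fun x n => F x n + G x n).
Proof.
  intros HF HG; refine (computable_ext _ _ _
    (computable_nat_rect C G F (fun _ _ _ a => S a) HG HF _) _).
  - now apply computable_succ, computable_pi2, computable_pi2, computable_arg.
  - intros x n _; induction (F x n); cbn; congruence.
Qed.

Lemma computable_sub C F G :
  computable C F -> computable C G -> computable C (fun x n => F x n - G x n).
Proof.
  intros HF HG; refine (computable_ext _ _ _
    (computable_nat_rect C F G (fun _ _ _ a => pred a) HF HG _) _).
  - now apply computable_pred, computable_pi2, computable_pi2, computable_arg.
  - intros x n _; induction (G x n) as [|k IH]; cbn; [lia|]; rewrite IH; lia.
Qed.

Lemma computable_mul C F G :
  computable C F -> computable C G -> computable C (fun x n => F x n * G x n).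
Proof.
  intros HF HG; refine (computable_ext _ _ _
    (computable_nat_rect C (fun _ _ => 0) F (fun x n _ a => G x n + a) _ HF _) _).
  - apply computable_const.
  - apply computable_add.
    + apply computable_subst; [exact HG | apply computable_pi1, computable_arg].
    + apply computable_pi2, computable_pi2, computable_arg.
  - intros x n _; induction (F x n); cbn; congruence.
Qed.

Lemma computable_if C b F G :
  computableb C b -> computable C F -> computable C G ->
  computable C (fun x n => if b x n then F x n else G x n).
Proof.
  intros Hb HF HG; refine (computable_ext _ _ _
    (computable_nat_rect C G (fun x n => Nat.b2n (b x n)) (fun x n _ _ => F x n)
       HG Hb _) _).
  - apply computable_subst; [exact HF | apply computable_pi1, computable_arg].
  - intros x n _; now destruct (b x n).
Qed.

Lemma computableb_if C b F G :
  computableb C b -> computableb C F -> computableb C G ->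
  computableb C (fun x n => if b x n then F x n else G x n).
Proof.
  intros Hb HF HG; refine (computable_ext _ _ _ (computable_if C _ _ _ Hb HF HG) _).
  intros x n _; now destruct (b x n).
Qed.

Lemma computableb_const C c : computableb C (fun _ _ => c).
Proof. exact (computable_const C (Nat.b2n c)). Qed.

Lemma computableb_negb C b : computableb C b -> computableb C (fun x n => negb (b x n)).
Proof. intro H; apply computableb_if; auto using computableb_const. Qed.

Lemma computableb_andb C b c :
  computableb C b -> computableb C c -> computableb C (fun x n => b x n && c x n).
Proof. intros; apply computableb_if; auto using computableb_const. Qed.

Lemma computableb_orb C b c :
  computableb C b -> computableb C c -> computableb C (fun x n => b x n || c x n).
Proof. intros; apply computableb_if; auto using computableb_const. Qed.

Lemma computableb_leb C F G :
  computable C F -> computable C G -> computableb C (fun x n => F x n <=? G x n).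
Proof.
  intros HF HG; refine (computable_ext _ _ _ (computable_sub C (fun _ _ => 1) _ _
    (computable_sub _ _ _ HF HG)) _).
  - apply computable_const.
  - intros x n _; destruct (Nat.leb_spec (F x n) (G x n)); cbn [Nat.b2n]; lia.
Qed.

Lemma computableb_ltb C F G :
  computable C F -> computable C G -> computableb C (fun x n => F x n <? G x n).
Proof. intros; apply computableb_leb; auto using computable_succ. Qed.

Lemma computableb_eqb C F G :
  computable C F -> computable C G -> computableb C (fun x n => F x n =? G x n).
Proof.
  intros HF HG; refine (computable_ext _ _ _ (computableb_andb _ _ _
    (computableb_leb _ _ _ HF HG) (computableb_leb _ _ _ HG HF)) _).
  intros x n _; f_equal; apply eq_true_iff_eq.
  rewrite andb_true_iff, !Nat.leb_le, Nat.eqb_eq; lia.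
Qed.

(** F picks the least witness, which is what [pMu] finds. *)
Lemma computable_search C G :
  computableb C (fun x m => G x (π1 m) (π2 m)) ->
  (forall x n, C x -> exists k, G x n k = true) ->
  exists F, computable C F /\ forall x n, C x -> G x n (F x n) = true.
Proof.
  intros HG Hex; apply computableb_negb in HG; destruct HG as [p Hp].
  pose (least x n k := G x n k = true /\ forall j, j < k -> G x n j = false).
  pose (F x n := epsilon (inhabits 0) (least x n)).
  assert (HF : forall x n, C x -> least x n (F x n)).
  { intros x n Cx; apply epsilon_spec.
    destruct (dec_inh_nat_subset_has_unique_least_element
                (fun k => G x n k = true)) as (k & (Hk & Hmin) & _); [|now apply Hex|].
    { intro k; destruct (G x n k); auto. }
    exists k; split; [exact Hk|]; intros j Hj; apply not_true_iff_false; intro E.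
    apply Hmin in E; lia. }
  exists F; split; [|intros x n Cx; now apply HF].
  exists (pMu p); intros x Cx n; destruct (HF x n Cx) as [Hyes Hno].
  apply eval_mu with (u := fun _ => 0).
  - intros j Hj; specialize (Hp x Cx ⟨n, j⟩); cbv beta in Hp.
    now rewrite pi1_pair, pi2_pair, (Hno j Hj) in Hp.
  - specialize (Hp x Cx ⟨n, F x n⟩); cbv beta in Hp.
    now rewrite pi1_pair, pi2_pair, Hyes in Hp.
Qed.

Lemma computable_div4 C F : computable C F -> computable C (fun x n => F x n / 4).
Proof.
  intro HF.
  destruct (computable_search C (fun x n k => (4 * k <=? F x n) && (F x n <? 4 * S k)))
    as (G & HG & Hspec).
  - assert (H : computable C (fun x m => F x (π1 m)))
      by apply (computable_subst _ _ _ HF), computable_pi1, computable_arg.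
    apply computableb_andb; [apply computableb_leb | apply computableb_ltb];
      auto using computable_mul, computable_const, computable_succ, computable_pi2,
                 computable_arg.
  - intros x n _; exists (F x n / 4); rewrite andb_true_iff, Nat.leb_le, Nat.ltb_lt.
    pose proof (Nat.div_mod_eq (F x n) 4);
      pose proof (Nat.mod_upper_bound (F x n) 4); lia.
  - refine (computable_ext _ _ _ HG _); intros x n Cx; specialize (Hspec x n Cx).
    apply andb_true_iff in Hspec as [H1 H2].
    apply Nat.leb_le in H1; apply Nat.ltb_lt in H2.
    apply (Nat.div_unique _ _ _ (F x n - 4 * G x n)); lia.
Qed.

Lemma computableb_forallb C P N :
  computableb C (fun x m => P x (π1 m) (π2 m)) -> computable C N ->
  computableb C (fun x n => forallb (P x n) (seq 0 (N x n))).
Proof.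
  intros HP HN; refine (computable_ext _ _ _
    (computable_nat_rect C (fun _ _ => 1) N
       (fun x n k a => if P x n k then a else 0) _ HN _) _).
  - apply computable_const.
  - apply computable_if; [|apply computable_pi2, computable_pi2, computable_arg
                          |apply computable_const].
    refine (computable_ext _ _ _ (computable_subst C _ (fun _ m => ⟨π1 m, π1 (π2 m)⟩) HP _) _).
    + apply computable_pair; repeat apply computable_pi1; try apply computable_pi2;
        apply computable_arg.
    + intros x m _; cbv beta; now rewrite pi1_pair, pi2_pair.
  - intros x n _; induction (N x n) as [|k IH]; [reflexivity|].
    rewrite seq_S, forallb_app; cbn [nat_rect forallb plus]; rewrite IH.
    now destruct (P x n k), (forallb (P x n) (seq 0 k)).
Qed.

Lemma computablel_decode C F :
  computable C F -> computablel C (fun x n => decode_seq (F x n)).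
Proof.
  intro HF; refine (computable_ext _ _ _ HF _).
  intros; now rewrite encode_decode_seq.
Qed.

Lemma computable_encode C F :
  computablel C F -> computable C (fun x n => encode_seq (F x n)).
Proof. trivial. Qed.

Lemma computablel_nil C : computablel C (fun _ _ => []).
Proof. exact (computable_const C 0). Qed.

Lemma computablel_cons C F G :
  computable C F -> computablel C G -> computablel C (fun x n => F x n :: G x n).
Proof. intros; now apply computable_succ, computable_pair. Qed.

Lemma computable_hd C F :
  computablel C F -> computable C (fun x n => hd 0 (F x n)).
Proof.
  intro HF; refine (computable_ext _ _ _ (computable_pi1 _ _ (computable_pred _ _ HF)) _).
  intros x n _; destruct (F x n); [reflexivity|]; cbn [encode_seq pred hd].
  apply pi1_pair.
Qed.

Lemma computablel_tl C F :
  computablel C F -> computablel C (fun x n => tl (F x n)).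
Proof.
  intro HF; refine (computable_ext _ _ _ (computable_pi2 _ _ (computable_pred _ _ HF)) _).
  intros x n _; destruct (F x n); [reflexivity|]; cbn [encode_seq pred tl].
  apply pi2_pair.
Qed.

Lemma computablel_skipn C F N :
  computablel C F -> computable C N -> computablel C (fun x n => skipn (N x n) (F x n)).
Proof.
  intros HF HN; refine (computable_ext _ _ _
    (computable_nat_rect C _ N (fun _ _ _ a => encode_seq (tl (decode_seq a))) HF HN _) _).
  - now apply computablel_tl, computablel_decode, computable_pi2, computable_pi2, computable_arg.
  - intros x n _; induction (N x n) as [|k IH]; [reflexivity|].
    cbn [nat_rect]; rewrite IH, decode_encode_seq; f_equal.
    generalize (F x n) as l; clear; intro l; revert l.
    induction k as [|k IH]; intros [|a l]; try reflexivity; apply IH.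
Qed.

Lemma computable_nth C F N :
  computable C N -> computablel C F -> computable C (fun x n => nth (N x n) (F x n) 0).
Proof.
  intros HN HF; refine (computable_ext _ _ _ (computable_hd _ _
    (computablel_skipn _ _ _ HF HN)) _).
  intros x n _; cbv beta; generalize (N x n) as k, (F x n) as l.
  induction k as [|k IH]; intros [|a l]; try reflexivity; apply IH.
Qed.

Lemma length_le_encode s : length s <= encode_seq s.
Proof.
  induction s as [|a s IH]; cbn [length encode_seq]; [lia|].
  pose proof (Cantor.to_nat_non_decreasing a (encode_seq s)); lia.
Qed.

(** The iteration works on pairs of the code of the remaining list and the
    accumulator.  The code of the list is at least its length, so that it can serve
    as the number of iterations; once the list is exhausted nothing changes. *)
Lemma computable_fold_left C B F St :
  computable C B -> computablel C F ->
  computable C (fun x m => St x (π1 m) (π1 (π2 m)) (π2 (π2 m))) ->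
  computable C (fun x n => fold_left (St x n) (F x n) (B x n)).
Proof.
  intros HB HF HS.
  pose (step x n (_ s : nat) :=
    if π1 s =? 0 then s
    else ⟨encode_seq (tl (decode_seq (π1 s))),
          St x n (π2 s) (hd 0 (decode_seq (π1 s)))⟩).
  refine (computable_ext _ _ _ (computable_pi2 _ _
    (computable_nat_rect C (fun x n => ⟨encode_seq (F x n), B x n⟩)
       (fun x n => encode_seq (F x n)) step _ HF _)) _).
  - now apply computable_pair.
  - assert (H : computable C (fun _ m => π2 (π2 m)))
      by apply computable_pi2, computable_pi2, computable_arg.
    assert (Hl : computablel C (fun _ m => decode_seq (π1 (π2 (π2 m)))))
      by now apply computablel_decode, computable_pi1.
    unfold step; apply computable_if; [|exact H|].
    + apply computableb_eqb; [now apply computable_pi1 | apply computable_const].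
    + apply computable_pair; [now apply computablel_tl|].
      refine (computable_ext _ _ _ (computable_subst C _
        (fun _ m => ⟨π1 m, ⟨π2 (π2 (π2 m)), hd 0 (decode_seq (π1 (π2 (π2 m))))⟩⟩) HS _) _).
      * apply computable_pair; [apply computable_pi1, computable_arg|].
        apply computable_pair; [now apply computable_pi2 | now apply computable_hd].
      * intros x m _; cbv beta; now rewrite pi1_pair, !pi2_pair, pi1_pair.
  - intros x n _; cbv beta.
    assert (Hstep : forall k l b,
      length l <= k ->
      nat_rect (fun _ => nat) ⟨encode_seq l, b⟩ (step x n) k = ⟨0, fold_left (St x n) l b⟩).
    2: now rewrite Hstep, pi2_pair by apply length_le_encode.
    (* The iteration starts at the innermost step, the fold at the head. *)
    assert (Hshift : forall k s,
      nat_rect (fun _ => nat) s (step x n) (S k)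
      = nat_rect (fun _ => nat) (step x n 0 s) (step x n) k).
    { intros k s; induction k as [|k IH]; [reflexivity|].
      cbn [nat_rect] in *; now rewrite IH. }
    induction k as [|k IH]; intros l b Hl.
    + now destruct l; [|cbn in Hl; lia].
    + rewrite Hshift; unfold step at 1; rewrite pi1_pair, decode_encode_seq.
      destruct l as [|a l]; cbn [encode_seq].
      * cbn [Nat.eqb]; apply (IH [] b); cbn; lia.
      * cbn [Nat.eqb tl hd fold_left]; rewrite pi2_pair; apply IH; cbn in Hl; lia.
Qed.

Lemma computable_length C F :
  computablel C F -> computable C (fun x n => length (F x n)).
Proof.
  intro HF; refine (computable_ext _ _ _
    (computable_fold_left C (fun _ _ => 0) F (fun _ _ a _ => S a) _ HF _) _).
  - apply computable_const.
  - now apply computable_succ, computable_pi1, computable_pi2, computable_arg.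
  - intros x n _; apply fold_left_S_0.
Qed.

Lemma computablel_rev_append C F G :
  computablel C F -> computablel C G ->
  computablel C (fun x n => rev_append (F x n) (G x n)).
Proof.
  intros HF HG; refine (computable_ext _ _ _
    (computable_fold_left C _ F (fun _ _ a h => S ⟨h, a⟩) HG HF _) _).
  - apply computable_succ, computable_pair;
      [apply computable_pi2 | apply computable_pi1]; apply computable_pi2, computable_arg.
  - intros x n _; generalize (G x n).
    induction (F x n) as [|a l IH]; intro s; [reflexivity | apply (IH (a :: s))].
Qed.

Lemma computablel_rev C F : computablel C F -> computablel C (fun x n => rev (F x n)).
Proof.
  intro HF; refine (computable_ext _ _ _
    (computablel_rev_append _ _ _ HF (computablel_nil C)) _).
  intros; cbv beta; now rewrite rev_append_rev, app_nil_r.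
Qed.

Lemma computablel_app C F G :
  computablel C F -> computablel C G -> computablel C (fun x n => F x n ++ G x n).
Proof.
  intros HF HG; refine (computable_ext _ _ _
    (computablel_rev_append _ _ _ (computablel_rev _ _ HF) HG) _).
  intros; cbv beta; now rewrite rev_append_rev, rev_involutive.
Qed.

Lemma computablel_firstn C F N :
  computable C N -> computablel C F -> computablel C (fun x n => firstn (N x n) (F x n)).
Proof.
  intros HN HF; refine (computable_ext _ _ _ (computablel_rev _ _
    (computablel_skipn _ _ _ (computablel_rev _ _ HF)
       (computable_sub _ _ _ (computable_length _ _ HF) HN))) _).
  intros x n _; cbv beta.
  now rewrite <- (length_rev (F x n)), <- firstn_rev, rev_involutive.
Qed.

Ltac computability :=
  repeat (cbv beta;
    first
      [ assumption
      | simple apply computable_const | simple apply computableb_const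
      | simple apply computablel_nil
      | simple apply computable_arg
      | simple apply computable_pi1 | simple apply computable_pi2
      | simple apply computable_pair
      | simple apply computable_succ | simple apply computable_pred
      | simple apply computable_add | simple apply computable_sub
      | simple apply computable_mul | simple apply computable_div4
      | simple apply computable_if | simple apply computableb_if
      | simple apply computableb_negb
      | simple apply computableb_andb | simple apply computableb_orb
      | simple apply computableb_ltb | simple apply computableb_leb
      | simple apply computableb_eqb
      | simple apply computableb_forallb
      | simple apply computable_length
      | simple apply computable_nth | simple apply computable_hd
      | simple apply computablel_decode | simple apply computablel_firstn
      | simple apply computablel_cons | simple apply computablel_app
      | simple apply computable_encode
      | simple apply computable_oracle ]).

(** * Questions about a program that knows its own index *)

Lemma eval_inv x p m v :
  eval x p m v ->
  match p with
  | pZero => v = 0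
  | pSucc => v = S m
  | pLeft => v = π1 m
  | pRight => v = π2 m
  | pOracle => v = x m
  | pPair p q => exists u u', eval x p m u /\ eval x q m u' /\ v = ⟨u, u'⟩
  | pComp p q => exists u, eval x q m u /\ eval x p u v
  | pRec p q =>
      π2 m = 0 /\ eval x p (π1 m) v \/
      exists k u, π2 m = S k /\ eval x (pRec p q) ⟨π1 m, k⟩ u /\
                  eval x q ⟨π1 m, ⟨k, u⟩⟩ v
  | pMu p =>
      (forall j, j < v -> exists u, eval x p ⟨m, j⟩ (S u)) /\ eval x p ⟨m, v⟩ 0
  end.
Proof.
  intros []; rewrite ?pi1_pair, ?pi2_pair; eauto 10.
Qed.

Lemma eval_deterministic x p n v v' : eval x p n v -> eval x p n v' -> v = v'.
Proof.
  intro H; revert v'; induction H; intros v' H'; apply eval_inv in H';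
    rewrite ?pi1_pair, ?pi2_pair in H'; auto.
  - destruct H' as (u' & w & E1 & E2 & ->).
    now rewrite (IHeval1 _ E1), (IHeval2 _ E2).
  - destruct H' as (u' & E1 & E2); apply IHeval1 in E1; subst u'; auto.
  - destruct H' as [[_ E1]|(? & ? & E & _)]; [auto | discriminate].
  - destruct H' as [[E _]|(k' & u' & [= <-] & E1 & E2)]; [discriminate|].
    apply IHeval1 in E1; subst u'; auto.
  - destruct H' as [Hlt E1]; destruct (Nat.lt_trichotomy k v') as [Hk|[Hk|Hk]]; [|exact Hk|].
    + destruct (Hlt k Hk) as [w Hw]; specialize (IHeval _ Hw); discriminate.
    + specialize (H0 _ Hk _ E1); discriminate.
Qed.

Lemma prog_index_inj p p' : prog_index p = prog_index p' -> p = p'.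
Proof.
  revert p'; induction p; intros [] E; cbn [prog_index] in E; try lia; try reflexivity.
  4: f_equal; apply IHp; lia.
  all: match type of E with _ + 4 * ?a = _ + 4 * ?b => assert (E' : a = b) by lia end;
    apply pair_inj in E' as [E1 E2]; f_equal; auto.
Qed.

(** A program can carry an arbitrary number as data, in the form of a subprogram
    that is never run. *)
Lemma prog_index_surj v : exists p, prog_index p = v.
Proof.
  induction v as [v IH] using (well_founded_induction lt_wf).
  destruct (le_lt_dec 5 v) as [Hv|Hv].
  - pose proof (Nat.div_mod_eq (v - 5) 4); pose proof (Nat.mod_upper_bound (v - 5) 4).
    set (u := (v - 5) / 4) in *; set (r := (v - 5) mod 4) in *.
    pose proof (Cantor.to_nat_non_decreasing (π1 u) (π2 u)) as Hu.
    rewrite pair_eta in Hu.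
    destruct (IH u) as [p Ep]; [lia|].
    destruct (IH (π1 u)) as [p1 E1]; [lia|].
    destruct (IH (π2 u)) as [p2 E2]; [lia|].
    assert (Hr : r = 0 \/ r = 1 \/ r = 2 \/ r = 3) by lia.
    destruct Hr as [Hr|[Hr|[Hr|Hr]]];
      [exists (pPair p1 p2) | exists (pComp p1 p2) | exists (pRec p1 p2) | exists (pMu p)];
      cbn [prog_index]; rewrite ?E1, ?E2, ?Ep, ?pair_eta; lia.
  - assert (H : v = 0 \/ v = 1 \/ v = 2 \/ v = 3 \/ v = 4) by lia.
    destruct H as [->|[->|[->|[->| ->]]]];
      [exists pZero|exists pSucc|exists pLeft|exists pRight|exists pOracle]; reflexivity.
Qed.

(** On input e this gives the pair of e and 0, on which a [pRec p q] runs p on e and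
    leaves q alone. *)
Definition feed_zero : prog := pPair (pPair pLeft pRight) pZero.

(** The index of [pComp (pRec p pv) feed_zero], where p has index q and pv has index
    v: on every input this program does what p does, and v is mere data. *)
Definition query (q v : nat) : nat :=
  6 + 4 * ⟨7 + 4 * ⟨q, v⟩, prog_index feed_zero⟩.

Definition query_body (e : nat) : nat := (π1 ((e - 6) / 4) - 7) / 4.

Lemma computable_query C F G :
  computable C F -> computable C G -> computable C (fun x n => query (F x n) (G x n)).
Proof. unfold query; intros; computability. Qed.

Lemma query_body_query q v : query_body (query q v) = ⟨q, v⟩.
Proof.
  unfold query_body, query.
  rewrite Nat.add_comm, Nat.add_sub, Nat.mul_comm, Nat.div_mul, pi1_pair by lia.
  now rewrite Nat.add_comm, Nat.add_sub, Nat.mul_comm, Nat.div_mul by lia.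
Qed.

Lemma char_fun_1 A n : char_fun A n = 1 <-> A n.
Proof. unfold char_fun; destruct excluded_middle_informative; intuition discriminate. Qed.

(** The jump runs a program on its own index, so that a search program that is
    wrapped by [query] finds in its input both its data v and its own index q, and
    can form the indices of further questions [query q v'].  This replaces the
    recursion theorem.  Determinism of [eval] is needed to conclude from a
    halting computation that the search has really met a witness. *)
Lemma self_query_spec C (test : baire -> nat -> nat -> bool) :
  computableb C (fun y m => test y (π1 m) (π2 m)) ->
  exists q, forall y v, C y ->
    (jump y (query q v) = 1 <-> exists t, test y (query q v) t = true).
Proof.
  intro Ht; apply computableb_negb in Ht; destruct Ht as [p Hp].
  assert (Hp' : forall y e t, C y -> eval y p ⟨e, t⟩ (Nat.b2n (negb (test y e t)))).
  { intros y e t Cy; specialize (Hp y Cy ⟨e, t⟩); now rewrite pi1_pair, pi2_pair in Hp. }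
  clear Hp; exists (prog_index (pMu p)); intros y v Cy.
  set (e := query _ v); unfold jump; rewrite char_fun_1.
  destruct (prog_index_surj v) as [pv Ev].
  assert (Ee : prog_index (pComp (pRec (pMu p) pv) feed_zero) = e)
    by (unfold e, query; rewrite <- Ev; reflexivity).
  assert (Hz : eval y feed_zero e ⟨e, 0⟩).
  { unfold feed_zero; rewrite <- (pair_eta e) at 1 2; repeat constructor. }
  clearbody e; split.
  - intros (p' & E' & u & Hu).
    rewrite <- Ee in E'; apply prog_index_inj in E'; subst p'.
    apply eval_inv in Hu as (e' & He' & Hu).
    rewrite <- (eval_deterministic _ _ _ _ _ Hz He') in Hu; clear e' He'.
    apply eval_inv in Hu; rewrite pi1_pair, pi2_pair in Hu.
    destruct Hu as [[_ Hu]|(? & ? & [=] & _)]; apply eval_inv in Hu as [_ Hu].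
    exists u; pose proof (eval_deterministic _ _ _ _ _ Hu (Hp' _ _ u Cy)).
    now destruct (test _ _ _).
  - intro Ht.
    destruct (dec_inh_nat_subset_has_unique_least_element
                (fun t => test y e t = true)) as (t & (Ht1 & Hmin) & _); [|exact Ht|].
    { intro t; destruct (test y e t); auto. }
    exists (pComp (pRec (pMu p) pv) feed_zero); split; [exact Ee|].
    exists t; econstructor; [exact Hz|]; constructor.
    apply eval_mu with (u := fun _ => 0).
    + intros j Hj; specialize (Hp' y e j Cy).
      destruct (test y e j) eqn:E; [|exact Hp'].
      apply Hmin in E; lia.
    + specialize (Hp' y e t Cy); now rewrite Ht1 in Hp'.
Qed.

Lemma jump_pZero y : jump y 0 = 1.
Proof. apply char_fun_1; exists pZero; split; [reflexivity | exists 0; constructor]. Qed.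

Lemma join_even x y i : join x y (2 * i) = x i.
Proof. unfold join; rewrite Nat.even_even; now rewrite Nat.div2_double. Qed.

Lemma join_odd x y i : join x y (S (2 * i)) = y i.
Proof. unfold join; rewrite Nat.even_succ, Nat.odd_even; now rewrite Nat.div2_succ_double. Qed.

(** The entry i of column l in the right half of a join. *)
Definition ask (y : baire) (l i : nat) : bool := y (S (2 * ⟨l, i⟩)) =? 1.

Lemma ask_column_below x (w : wellorder) n l i :
  ask (join x (fun j => let (m, k) := Cantor.of_nat j in
                if rlt_dec w m n then jump_column x w m k else 0)) l i = true
  <-> rlt w l n /\ jump_column x w l i = 1.
Proof.
  unfold ask; rewrite join_odd, Cantor.cancel_of_to, Nat.eqb_eq.
  destruct (rlt_dec w l n); intuition discriminate.
Qed.

Lemma ask_iter_jump x (w : wellorder) l i :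
  ask (iter_jump x w) l i = true <-> rdom w l /\ jump_column x w l i = 1.
Proof.
  unfold ask, iter_jump, rdom, rle; rewrite join_odd, Cantor.cancel_of_to, Nat.eqb_eq.
  destruct (Nat.eq_dec _ 1); intuition discriminate.
Qed.

(** Every column of the hierarchy has this entry, so that asking for it tells from
    the oracle alone whether column l is one of those below the current stage. *)
Lemma jump_column_0 x (w : wellorder) n : jump_column x w n 0 = 1.
Proof. rewrite jump_column_unfold; apply jump_pZero. Qed.

Definition prefixb (s t : list nat) : bool :=
  encode_seq (firstn (length s) t) =? encode_seq s.

Lemma encode_inj s t : encode_seq s = encode_seq t -> s = t.
Proof. intro E; rewrite <- (decode_encode_seq s), E; apply decode_encode_seq. Qed.

Lemma prefixb_spec s t : prefixb s t = true <-> exists r, t = s ++ r.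
Proof.
  unfold prefixb; rewrite Nat.eqb_eq; split.
  - intro E; apply encode_inj in E; exists (skipn (length s) t).
    now rewrite <- E at 1; rewrite firstn_skipn.
  - intros [r ->]; now rewrite firstn_app, Nat.sub_diag, firstn_all, app_nil_r.
Qed.

(** * Securing a node along the jump hierarchy *)

Definition covered (x : baire) (s : list nat) : Prop :=
  exists t k r, x t = S k /\ s = decode_seq k ++ r.

(** A one-jump-per-stage version of the ranks: the gap between l and m gives room
    for the two quantifiers of infinitely many successors.  As a
    recursion along r it determines P when r is a wellorder. *)
Definition secures (x r : baire) (P : nat -> list nat -> Prop) : Prop :=
  forall n s, P n s <->
    covered x s \/
    exists l m, rlt r l n /\ rlt r m l /\
      forall b, exists j k, rlt r j m /\ b <= k /\ P j (s ++ [k]).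

(** What the program with index q checks at step t of its search, for the four kinds
    of questions, when the oracle y consists of x and the columns below the current
    one.
    Kind 0: is s, with code a, secured here?  Either x(t) lists a prefix of s, or t
    codes l and m such that column l refutes the question of kind 1.
    Kind 1: is m not below the current column, or is there a bound t beyond which
    no successor of s is secured below m?
    Kind 2: is there a successor of s beyond a given bound that is secured at some
    stage below the current one?
    Kind 3: is s itself secured at some stage below the current one? *)
Definition secured_body (y : baire) (q kind a t : nat) : bool :=
  if kind =? 0 then
    (0 <? y (2 * t)) && prefixb (decode_seq (pred (y (2 * t)))) (decode_seq a)
    || ask y (π1 t) 0 && negb (ask y (π1 t) (query q ⟨1, ⟨π2 t, a⟩⟩))
  else if kind =? 1 then
    negb (ask y (π1 a) 0) || negb (ask y (π1 a) (query q ⟨2, ⟨π2 a, t⟩⟩))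
  else if kind =? 2 then
    ask y (π1 t) (query q ⟨0, encode_seq (decode_seq (π1 a) ++ [π2 a + π2 t])⟩)
  else ask y t (query q ⟨0, a⟩).

Definition secured_test (y : baire) (e t : nat) : bool :=
  secured_body y (π1 (query_body e)) (π1 (π2 (query_body e))) (π2 (π2 (query_body e))) t.

Lemma computableb_secured_test C :
  computableb C (fun y m => secured_test y (π1 m) (π2 m)).
Proof.
  unfold secured_test, secured_body, ask, query, query_body, prefixb.
  computability.
Qed.

#[local] Opaque query Cantor.to_nat Cantor.of_nat.

(** D asks whether a node is secured at the current stage (kind 0), and L whether it
    is secured at an earlier one (kind 3).  The pair of them identifies the rank. *)
Lemma secured_queries :
  exists D L : nat -> nat,
    (forall C F, computable C F -> computable C (fun x n => D (F x n))) /\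
    (forall C F, computable C F -> computable C (fun x n => L (F x n))) /\
    forall (x : baire) (w : wellorder),
      let P n s := jump_column x w n (D (encode_seq s)) = 1 in
      secures x w P /\
      forall n s, jump_column x w n (L (encode_seq s)) = 1 <-> exists j, rlt w j n /\ P j s.
Proof.
  destruct (self_query_spec (fun _ => True) secured_test
              (computableb_secured_test _)) as [q Hq].
  exists (fun c => query q ⟨0, c⟩), (fun c => query q ⟨3, c⟩).
  split; [|split]; [intros; apply computable_query; computability .. |].
  intros x w P.
  set (y n := join x (fun j => let (m, k) := Cantor.of_nat j in
                        if rlt_dec w m n then jump_column x w m k else 0)).
  assert (Hcol : forall n kind a, jump_column x w n (query q ⟨kind, a⟩) = 1 <->
                   exists t, secured_body (y n) q kind a t = true).
  { intros n' kind a; rewrite jump_column_unfold, (Hq _ _ I); fold (y n').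
    unfold secured_test; split; intros [t Ht]; exists t; revert Ht;
      now rewrite query_body_query, pi1_pair, !pi2_pair, pi1_pair. }
  assert (Hask : forall n l i,
            ask (y n) l i = true <-> rlt w l n /\ jump_column x w l i = 1)
    by (intros; apply ask_column_below).
  assert (Hask0 : forall n l, ask (y n) l 0 = true <-> rlt w l n).
  { intros; rewrite Hask; pose proof (jump_column_0 x w l); tauto. }
  assert (Hy : forall n t, y n (2 * t) = x t) by (intros; apply join_even).
  clearbody y; clear Hq.
  assert (HE : forall m s b, jump_column x w m (query q ⟨2, ⟨encode_seq s, b⟩⟩) = 1 <->
                 exists j k, rlt w j m /\ b <= k /\ P j (s ++ [k])).
  { intros m s' b; rewrite Hcol; unfold secured_body; cbn [Nat.eqb]; split.
    - intros [t Ht]; rewrite !pi1_pair, pi2_pair, decode_encode_seq in Ht.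
      apply Hask in Ht as [Ht1 Ht2]; exists (π1 t), (b + π2 t).
      split; [exact Ht1|]; split; [lia | exact Ht2].
    - intros (j & k & Hj & Hk & HP); exists ⟨j, k - b⟩.
      rewrite !pi1_pair, !pi2_pair, decode_encode_seq, Hask.
      replace (b + (k - b)) with k by lia; easy. }
  assert (HR : forall l m s, jump_column x w l (query q ⟨1, ⟨m, encode_seq s⟩⟩) <> 1 <->
                 rlt w m l /\ forall b, exists j k, rlt w j m /\ b <= k /\ P j (s ++ [k])).
  { intros l m s'; rewrite Hcol; unfold secured_body; cbn [Nat.eqb].
    setoid_rewrite orb_true_iff; setoid_rewrite negb_true_iff.
    setoid_rewrite <- not_true_iff_false.
    setoid_rewrite pi2_pair; setoid_rewrite pi1_pair.
    setoid_rewrite Hask0; setoid_rewrite Hask; setoid_rewrite HE.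
    split.
    - intro H; assert (Hm : rlt w m l)
        by (apply NNPP; intro; apply H; exists 0; now left).
      split; [exact Hm|]; intro b; apply NNPP; intro; apply H; exists b; right; tauto.
    - intros [Hm H] [b [Hb|Hb]]; [tauto|]; apply Hb; auto. }
  split; intros n s.
  - unfold P at 1; rewrite Hcol; unfold secured_body; cbn [Nat.eqb].
    setoid_rewrite orb_true_iff; setoid_rewrite andb_true_iff.
    setoid_rewrite prefixb_spec; setoid_rewrite negb_true_iff.
    setoid_rewrite <- not_true_iff_false; setoid_rewrite Nat.ltb_lt.
    setoid_rewrite Hask0; setoid_rewrite Hask; setoid_rewrite Hy.
    setoid_rewrite decode_encode_seq.
    split.
    + intros [t [[Ht [r Er]]|[Hl Hm]]].
      * left; exists t, (pred (x t)), r; split; [lia | exact Er].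
      * right; exists (π1 t), (π2 t); split; [exact Hl|].
        apply HR; tauto.
    + intros [(t & k & r & Ht & Er)|(l & m & Hl & Hm)].
      * exists t; left; split; [lia|]; exists r; now rewrite Ht.
      * exists ⟨l, m⟩; right; rewrite pi1_pair, pi2_pair; apply HR in Hm; tauto.
  - rewrite Hcol; unfold secured_body; cbn [Nat.eqb].
    setoid_rewrite Hask; reflexivity.
Qed.

(** * Securing and isomorphisms of wellorders *)

Lemma rlt_dom r m n : is_wellorder r -> rlt r m n -> rdom r m /\ rdom r n.
Proof. intros Hr [H _]; now apply (wo_dom r Hr). Qed.

Lemma rlt_trans r l m n : is_wellorder r -> rlt r l m -> rlt r m n -> rlt r l n.
Proof.
  intros Hr [H1 N1] [H2 N2]; split; [now apply (wo_trans r Hr l m n)|].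
  intros ->; apply N1; now apply (wo_antisym r Hr).
Qed.

Lemma rlt_total r m n :
  is_wellorder r -> rdom r m -> rdom r n -> rlt r m n \/ m = n \/ rlt r n m.
Proof.
  intros Hr Hm Hn; unfold rlt; destruct (Nat.eq_dec m n); auto.
  destruct (wo_total r Hr m n Hm Hn); auto.
Qed.

Lemma exists_least r (A : nat -> Prop) n :
  is_wellorder r -> rdom r n -> A n ->
  exists m, rdom r m /\ A m /\ forall l, rlt r l m -> ~ A l.
Proof.
  intros Hr; induction n as [n IH] using (well_founded_induction (wo_wf r Hr)).
  intros Hn HA; destruct (classic (exists l, rlt r l n /\ A l)) as [(l & Hl & HAl)|Hno].
  - apply (IH l Hl); [now apply (rlt_dom r l n Hr) | exact HAl].
  - exists n; split; [exact Hn|]; split; [exact HA|]; intros l Hl HAl; apply Hno; eauto.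
Qed.

Lemma secures_mono x r P m n s :
  is_wellorder r -> secures x r P -> P m s -> rlt r m n -> P n s.
Proof.
  intros Hr HP Hm Hmn; apply HP in Hm as [Hs|(l & l' & Hl & H)]; apply HP; auto.
  right; exists l, l'; split; [now apply (rlt_trans r l m n) | exact H].
Qed.

Definition order_iso (r r' : baire) (h : nat -> nat) : Prop :=
  (forall n, rdom r n -> rdom r' (h n)) /\
  (forall m, rdom r' m -> exists n, rdom r n /\ h n = m) /\
  (forall m n, rdom r m -> rdom r n -> rlt r m n <-> rlt r' (h m) (h n)).

Lemma same_type_order_iso r r' :
  is_wellorder r -> same_type r r' -> exists h, order_iso r r' h.
Proof.
  intros Hr (h & Hdom & Honto & Hle); exists h; split; [exact Hdom|]; split; [exact Honto|].
  intros m n Hm Hn; unfold rlt; rewrite <- (Hle m n Hm Hn).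
  enough (h m = h n <-> m = n) by tauto; split; [|congruence].
  pose proof (proj1 (Hle m m Hm Hm) Hm) as Hmm.
  intro E; apply (wo_antisym r Hr); apply Hle; auto; now rewrite <- E in *.
Qed.

(** Induction along r: stages below h(n) are exactly the images of stages below n. *)
Lemma secures_iso x (r r' : baire) h P P' :
  is_wellorder r -> is_wellorder r' ->
  order_iso r r' h -> secures x r P -> secures x r' P' ->
  forall n s, rdom r n -> P n s <-> P' (h n) s.
Proof.
  intros Hr Hr' (Hdom & Honto & Hlt) HP HP' n.
  induction n as [n IH] using (well_founded_induction (wo_wf r Hr)); intros s Hn.
  assert (Hbelow : forall n, rdom r n -> forall l', rlt r' l' (h n) ->
            exists l, rlt r l n /\ h l = l').
  { intros n' Hn' l' Hl'; destruct (Honto l') as (l & Hl & <-);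
      [now apply (rlt_dom r' _ (h n'))|].
    exists l; split; [now apply Hlt | reflexivity]. }
  rewrite (HP n s), (HP' (h n) s); split; (intros [Hs|H]; [now left | right]).
  - destruct H as (l & m & Hl & Hm & H).
    pose proof (rlt_dom r l n Hr Hl); pose proof (rlt_dom r m l Hr Hm).
    exists (h l), (h m); split; [now apply Hlt|]; split; [now apply Hlt|].
    intro b; destruct (H b) as (j & k & Hj & Hk & HPj).
    pose proof (rlt_dom r j m Hr Hj).
    exists (h j), k; split; [apply Hlt; tauto|]; split; [exact Hk|].
    apply IH; [|tauto | exact HPj].
    apply (rlt_trans r j m n Hr Hj), (rlt_trans r m l n Hr Hm Hl).
  - destruct H as (l' & m' & Hl & Hm & H).
    apply Hbelow in Hl as (l & Hl & <-); [|exact Hn].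
    pose proof (rlt_dom r l n Hr Hl).
    apply Hbelow in Hm as (m & Hm & <-); [|tauto].
    pose proof (rlt_dom r m l Hr Hm).
    exists l, m; split; [exact Hl|]; split; [exact Hm|].
    intro b; destruct (H b) as (j' & k & Hj & Hk & HPj).
    apply Hbelow in Hj as (j & Hj & <-); [|tauto].
    pose proof (rlt_dom r j m Hr Hj).
    exists j, k; split; [exact Hj|]; split; [exact Hk|].
    apply IH; [|tauto | exact HPj].
    apply (rlt_trans r j m n Hr Hj), (rlt_trans r m l n Hr Hm Hl).
Qed.

(** * The wellorder of attempts *)

Lemma restrict_S g n : restrict g (S n) = restrict g n ++ [g n].
Proof. unfold restrict; now rewrite seq_S, map_app. Qed.

Lemma restrict_length g n : length (restrict g n) = n.
Proof. unfold restrict; now rewrite length_map, length_seq. Qed.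

Lemma nth_restrict g n i : i < n -> nth i (restrict g n) 0 = g i.
Proof.
  intro H; unfold restrict.
  rewrite (nth_indep _ 0 (g 0)) by (now rewrite length_map, length_seq).
  now rewrite map_nth, seq_nth.
Qed.

(** Dependent choice along the finite sequences. *)
Lemma exists_path (R : list nat -> Prop) (Q : list nat -> nat -> Prop) :
  R [] -> (forall s, R s -> exists k, Q s k /\ R (s ++ [k])) ->
  exists g, forall n, R (restrict g n) /\ Q (restrict g n) (g n).
Proof.
  intros H0 HS.
  pose (next s := epsilon (inhabits 0) (fun k => Q s k /\ R (s ++ [k]))).
  assert (Hnext : forall s, R s -> Q s (next s) /\ R (s ++ [next s]))
    by (intros s Hs; exact (epsilon_spec (inhabits 0) _ (HS s Hs))).
  pose (path := nat_rect (fun _ => list nat) [] (fun _ s => s ++ [next s])).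
  exists (fun n => next (path n)).
  assert (E : forall n, restrict (fun n => next (path n)) n = path n).
  { induction n as [|n IH]; [reflexivity|]; now rewrite restrict_S, IH. }
  intro n; rewrite E; enough (H : R (path n)) by (split; [exact H | now apply Hnext]).
  induction n as [|n IH]; [exact H0 | now apply Hnext].
Qed.

Lemma restrict_prefix g n s r : restrict g n = s ++ r -> s = restrict g (length s).
Proof.
  revert n; induction r as [|a r IH] using rev_ind; intros n E.
  - rewrite app_nil_r in E; now rewrite <- E, restrict_length.
  - rewrite app_assoc in E; destruct n as [|n]; [now apply app_cons_not_nil in E|].
    rewrite restrict_S in E; apply app_inj_tail in E as [E _]; exact (IH n E).
Qed.

(** The relation R holds between each proper prefix and the entry that follows it. *)
Definition steps (R : list nat -> nat -> Prop) (s : list nat) : Prop :=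
  forall p a q, s = p ++ a :: q -> R p a.

Lemma steps_nil R : steps R [].
Proof. intros [] a q [=]. Qed.

Lemma steps_snoc R s a : steps R (s ++ [a]) <-> steps R s /\ R s a.
Proof.
  split.
  - intro H; split; [|now apply (H s a [])].
    intros p b q ->; apply (H p b (q ++ [a])); now rewrite <- app_assoc.
  - intros [Hs Ha] p b q E; destruct q as [|c q _] using rev_ind.
    + apply app_inj_tail in E as [<- <-]; exact Ha.
    + rewrite app_comm_cons, app_assoc in E; apply app_inj_tail in E as [-> _].
      now apply (Hs p b q).
Qed.

Lemma steps_app R s r : steps R (s ++ r) -> steps R s.
Proof. intros H p a q ->; apply (H p a (q ++ r)); now rewrite <- app_assoc. Qed.

Lemma steps_ext R R' s : (forall p a, R p a <-> R' p a) -> steps R s <-> steps R' s.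
Proof. intro E; split; intros H p a q Es; apply E; now apply (H p a q). Qed.

Definition stepsb (f : list nat -> nat -> bool) (s : list nat) : bool :=
  forallb (fun j => f (firstn j s) (nth j s 0)) (seq 0 (length s)).

Lemma stepsb_spec f s : stepsb f s = true <-> steps (fun p a => f p a = true) s.
Proof.
  unfold stepsb; rewrite forallb_forall; split.
  - intros H p a q ->; specialize (H (length p)).
    rewrite firstn_app, Nat.sub_diag, firstn_all, app_nil_r, nth_middle in H.
    apply H, in_seq; rewrite length_app; cbn; lia.
  - intros H j Hj; apply in_seq in Hj.
    destruct (nth_split s 0 (proj2 Hj)) as (p & q & E & El).
    rewrite E at 1; rewrite <- El at 1.
    rewrite firstn_app, Nat.sub_diag, firstn_all, app_nil_r; now apply (H p _ q).
Qed.

Lemma covered_app x s r : covered x s -> covered x (s ++ r).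
Proof.
  intros (t & k & q & Et & ->); exists t, k, (q ++ r); now rewrite app_assoc.
Qed.

(** An attempt u proposes the bound at p in position [slot p].  Only every fourth
    position counts: the other three make room for three attempts between u and
    those of its extensions that propose the next bound, as securing a node uses
    up stages l, m and j below n. *)
Definition slot (p : list nat) : nat := 4 * encode_seq p + 3.

Definition obeys (u s : list nat) : Prop :=
  steps (fun p a => slot p < length u /\ nth (slot p) u 0 <= a) s.

Definition obeysb (u s : list nat) : bool :=
  stepsb (fun p a => (slot p <? length u) && (nth (slot p) u 0 <=? a)) s.

(** An attempt is refuted by a listed sequence that obeys all its bounds; only the
    first [length u] entries of x are consulted, so that this is decidable from x
    and prefixes of attempts are attempts. *)
Definition attempt (x : baire) (u : list nat) : Prop :=
  forall t k, t < length u -> x t = S k -> ~ obeys u (decode_seq k).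

Definition attemptb (x : baire) (u : list nat) : bool :=
  forallb (fun t => (x t =? 0) || negb (obeysb u (decode_seq (pred (x t)))))
    (seq 0 (length u)).

Lemma obeysb_spec u s : obeysb u s = true <-> obeys u s.
Proof.
  unfold obeysb; rewrite stepsb_spec; apply steps_ext; intros p a.
  now rewrite andb_true_iff, Nat.ltb_lt, Nat.leb_le.
Qed.

Lemma attemptb_spec x u : attemptb x u = true <-> attempt x u.
Proof.
  unfold attemptb; rewrite forallb_forall; split.
  - intros H t k Ht Ek Ho; specialize (H t); rewrite Ek in H; cbn [Nat.eqb orb pred] in H.
    apply obeysb_spec in Ho; rewrite Ho in H; discriminate H; apply in_seq; lia.
  - intros H t Ht; apply in_seq in Ht; destruct (x t) as [|k] eqn:Ek; [reflexivity|].
    cbn [Nat.eqb orb pred]; apply negb_true_iff, not_true_iff_false.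
    rewrite obeysb_spec; apply (H t k); [lia | exact Ek].
Qed.

Lemma obeys_app u v s : obeys u s -> obeys (u ++ v) s.
Proof.
  intros H p a q E; destruct (H p a q E) as [Hl Ha].
  rewrite length_app, app_nth1 by exact Hl; lia.
Qed.

Lemma attempt_app x u v : attempt x (u ++ v) -> attempt x u.
Proof.
  intros H t k Ht Ek Ho; apply (H t k); [rewrite length_app; lia | exact Ek |].
  now apply obeys_app.
Qed.

(** Kleene-Brouwer order: extensions come first, then comparison at the first
    difference. *)
Fixpoint kb (u v : list nat) : bool :=
  match u, v with
  | _, [] => true
  | [], _ :: _ => false
  | a :: u, b :: v => (a <? b) || (a =? b) && kb u v
  end.

Lemma kb_cons a u b v :
  kb (a :: u) (b :: v) = true <-> a < b \/ a = b /\ kb u v = true.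
Proof. cbn [kb]; now rewrite orb_true_iff, andb_true_iff, Nat.ltb_lt, Nat.eqb_eq. Qed.

Lemma kb_refl u : kb u u = true.
Proof. induction u; [reflexivity | apply kb_cons; auto]. Qed.

Lemma kb_nil u : kb u [] = true.
Proof. now destruct u. Qed.

Lemma kb_antisym u v : kb u v = true -> kb v u = true -> u = v.
Proof.
  revert v; induction u as [|a u IH]; intros [|b v] H1 H2; try discriminate; try reflexivity.
  apply kb_cons in H1 as [?|[-> ?]], H2 as [?|[? ?]]; try lia; f_equal; auto.
Qed.

Lemma kb_trans u v r : kb u v = true -> kb v r = true -> kb u r = true.
Proof.
  revert v r; induction u as [|a u IH]; intros [|b v] [|c r] H1 H2;
    try discriminate; try reflexivity.
  apply kb_cons; apply kb_cons in H1 as [?|[-> ?]], H2 as [?|[-> ?]]; eauto; left; lia.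
Qed.

Lemma kb_total u v : kb u v = true \/ kb v u = true.
Proof.
  revert v; induction u as [|a u IH]; intros [|b v]; auto.
  rewrite !kb_cons; destruct (Nat.lt_trichotomy a b) as [H|[->|H]]; auto.
  destruct (IH v); auto.
Qed.

Definition left_of (u v : list nat) : Prop :=
  exists p a b q r, u = p ++ a :: q /\ v = p ++ b :: r /\ a < b.

Lemma kb_cases u v : kb u v = true -> (exists q, u = v ++ q) \/ left_of u v.
Proof.
  revert v; induction u as [|a u IH]; intros [|b v] H;
    try discriminate; try (left; eexists; reflexivity).
  - apply kb_cons in H; revert H; intros [H|[-> H]].
    + right; now exists [], a, b, u, v.
    + destruct (IH _ H) as [[q ->]|(p & c & d & q & r & -> & -> & Hcd)].
      * left; now exists q.
      * right; now exists (b :: p), c, d, q, r.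
Qed.

Lemma left_of_snoc v u m :
  left_of v (u ++ [m]) -> left_of v u \/ exists k q, k < m /\ v = u ++ k :: q.
Proof.
  intros (p & a & b & q & r & -> & E & Hab); destruct r as [|c r _] using rev_ind.
  - apply app_inj_tail in E as [-> ->]; right; now exists a, q.
  - rewrite app_comm_cons, app_assoc in E; apply app_inj_tail in E as [-> _].
    left; now exists p, a, b, q, r.
Qed.

Definition kb_lt (x : baire) (u v : list nat) : Prop :=
  attempt x u /\ attempt x v /\ kb u v = true /\ u <> v.

Definition extends (x : baire) (v u : list nat) : Prop :=
  exists m, v = u ++ [m] /\ attempt x v.

(** The classical argument that the Kleene-Brouwer order of a wellfounded tree is
    wellfounded, done by induction along the tree.  The subtrees above u ++ [m] are
    treated in increasing order of m, and what lies to the left of u ++ [m] lies to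
    the left of u or in an earlier subtree. *)
Lemma kb_lt_acc_above x u :
  Acc (extends x) u ->
  (forall v, left_of v u -> attempt x v -> Acc (kb_lt x) v) ->
  forall q, attempt x (u ++ q) -> Acc (kb_lt x) (u ++ q).
Proof.
  induction 1 as [u _ IH]; intro Hleft.
  assert (Hchild : forall m q, attempt x (u ++ m :: q) -> Acc (kb_lt x) (u ++ m :: q)).
  { intro m; induction m as [m IHm] using (well_founded_induction lt_wf); intros q.
    change (m :: q) with ([m] ++ q); rewrite app_assoc; intro Hq; apply IH; [| |exact Hq].
    - exists m; split; [reflexivity | now apply attempt_app in Hq].
    - intros v Hv; apply left_of_snoc in Hv as [Hv|(k & r & Hk & ->)]; auto. }
  intros [|m q] Hq; [|now apply Hchild].
  rewrite app_nil_r in *; constructor; intros v (Hv & _ & Hkb & Hne).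
  apply kb_cases in Hkb as [[[|m q] ->]|Hvu]; auto.
  now rewrite app_nil_r in Hne.
Qed.

Lemma kb_lt_wf x : Acc (extends x) [] -> well_founded (kb_lt x).
Proof.
  intros Hx u; constructor; intros v (Hv & _).
  apply (kb_lt_acc_above x [] Hx); [|exact Hv].
  intros v' (p & a & b & q & r & _ & E & _); now destruct p.
Qed.

(** An infinite branch b would propose a bound at every node, and T, having
    infinitely many successors everywhere, has a branch g that obeys b.  The prefix of g
    that puts g into the open set refutes a sufficiently long part of b. *)
Lemma attempts_acc x T :
  laver_tree T -> (forall g, body T g -> coded_open x g) -> Acc (extends x) [].
Proof.
  intros (_ & HT0 & HT) Hopen; apply NNPP; intro Hacc.
  destruct (exists_path (fun u => ~ Acc (extends x) u) (fun u m => attempt x (u ++ [m])) Hacc)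
    as [b Hb].
  { intros u Hu; apply NNPP; intro Hno; apply Hu; constructor; intros v (m & -> & Hm).
    apply NNPP; intro Hv; apply Hno; now exists m. }
  assert (Hb' : forall n, attempt x (restrict b (S n)))
    by (intro n; rewrite restrict_S; apply Hb).
  clear Hb.
  destruct (exists_path T (fun s k => b (slot s) <= k) HT0) as [g Hg].
  { intros s Hs; destruct (HT s Hs (b (slot s))) as (k & Hk & Hsk); now exists k. }
  assert (Hobey : forall N, exists M, forall M', M <= M' -> obeys (restrict b M') (restrict g N)).
  { induction N as [|N [M IH]]; [exists 0; intros; apply steps_nil|].
    exists (M + S (slot (restrict g N))); intros M' HM.
    rewrite restrict_S; apply steps_snoc; split; [apply IH; lia|].
    rewrite restrict_length, nth_restrict by lia.
    split; [lia | apply Hg]. }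
  destruct (Hopen g) as (n & k & Ek & N & Es); [intro n; apply Hg|].
  destruct (Hobey N) as [M HM].
  apply (Hb' (n + M) n k); [rewrite restrict_length; lia | exact Ek |].
  rewrite Es; apply HM; lia.
Qed.

Definition attempt_order (x : baire) : baire := fun n =>
  Nat.b2n (attemptb x (decode_seq (π1 n)) && attemptb x (decode_seq (π2 n))
           && kb (decode_seq (π1 n)) (decode_seq (π2 n))).

Lemma attempt_order_rle x m n :
  rle (attempt_order x) m n <->
  attempt x (decode_seq m) /\ attempt x (decode_seq n) /\
  kb (decode_seq m) (decode_seq n) = true.
Proof.
  unfold rle, attempt_order; rewrite pi1_pair, pi2_pair, <- !attemptb_spec.
  destruct (attemptb x _), (attemptb x _), (kb _ _); cbn; intuition discriminate.
Qed.

Lemma attempt_order_rdom x n : rdom (attempt_order x) n <-> attempt x (decode_seq n).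
Proof. unfold rdom; rewrite attempt_order_rle; pose proof (kb_refl (decode_seq n)); tauto. Qed.

Lemma attempt_order_wellorder x :
  Acc (extends x) [] -> is_wellorder (attempt_order x).
Proof.
  intro Hx; constructor.
  - intro k; unfold attempt_order; destruct (_ && _); auto.
  - intros m n; rewrite !attempt_order_rdom, attempt_order_rle; tauto.
  - intros m n; rewrite !attempt_order_rle; intros (_ & _ & H1) (_ & _ & H2).
    rewrite <- (encode_decode_seq m), <- (encode_decode_seq n); f_equal.
    now apply kb_antisym.
  - intros l m n; rewrite !attempt_order_rle; intuition eauto using kb_trans.
  - intros m n; rewrite !attempt_order_rdom, !attempt_order_rle.
    destruct (kb_total (decode_seq m) (decode_seq n)); tauto.
  - intro n; apply (Acc_incl _ _ (fun m n => kb_lt x (decode_seq m) (decode_seq n))).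
    + intros m k [Hle Hne]; apply attempt_order_rle in Hle as (Hm & Hk & Hkb).
      repeat split; auto; intro E; apply Hne.
      now rewrite <- (encode_decode_seq m), <- (encode_decode_seq k), E.
    + apply Acc_inverse_image, kb_lt_wf, Hx.
Qed.

(** One entry of the left list of a Kleene-Brouwer comparison.  The states 0 and 1
    are the final answers; state c + 2 means that the lists have agreed so far and
    that the right one continues with the list coded by c. *)
Definition kb_step (v a : nat) : nat :=
  if v <=? 1 then v
  else if v - 2 =? 0 then 1
  else if a <? hd 0 (decode_seq (v - 2)) then 1
  else if a =? hd 0 (decode_seq (v - 2)) then 2 + encode_seq (tl (decode_seq (v - 2)))
  else 0.

Lemma kb_fold u v :
  kb u v = (let r := fold_left kb_step u (2 + encode_seq v) in (r =? 1) || (r =? 2)).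
Proof.
  assert (Hstop : forall u r, r <= 1 -> fold_left kb_step u r = r).
  { clear; intros u r Hr; induction u as [|a u IH]; [reflexivity|].
    cbn [fold_left]; unfold kb_step at 2; now rewrite (proj2 (Nat.leb_le r 1) Hr). }
  cbv zeta; revert v; induction u as [|a u IH]; intros [|b v]; try reflexivity.
  - cbn [fold_left]; unfold kb_step at 2 4; cbn; now rewrite Hstop by lia.
  - cbn [fold_left kb].
    assert (E : kb_step (2 + encode_seq (b :: v)) a
                = if a <? b then 1 else if a =? b then 2 + encode_seq v else 0).
    { unfold kb_step; replace (2 + encode_seq (b :: v) - 2) with (encode_seq (b :: v)) by lia.
      rewrite decode_encode_seq; reflexivity. }
    rewrite E; destruct (a <? b), (a =? b); cbn [orb andb]; rewrite ?Hstop by lia; auto.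
Qed.

Lemma computableb_kb C F G :
  computablel C F -> computablel C G -> computableb C (fun x n => kb (F x n) (G x n)).
Proof.
  intros HF HG.
  assert (H : computable C (fun x n =>
    fold_left kb_step (F x n) (2 + encode_seq (G x n)))).
  { apply (computable_fold_left C _ F (fun _ _ => kb_step)); unfold kb_step; computability.
    all: apply computablel_tl; computability. }
  apply (computable_ext _ (fun x n =>
    let r := fold_left kb_step (F x n) (2 + encode_seq (G x n)) in
    Nat.b2n ((r =? 1) || (r =? 2)))).
  - cbv zeta; apply computableb_orb; computability.
  - intros; now rewrite kb_fold.
Qed.

Lemma attempt_order_computable : computable (fun _ => True) (fun x n => attempt_order x n).
Proof.
  unfold attempt_order, attemptb, obeysb, stepsb, slot.
  apply computableb_andb; [computability | apply computableb_kb; computability].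
Qed.

(** * The root is secured *)

Lemma encode_snoc_gt s k : encode_seq s < encode_seq (s ++ [k]).
Proof.
  induction s as [|a s IH]; cbn [encode_seq app]; [lia|].
  apply -> Nat.succ_lt_mono.
  revert IH; generalize (encode_seq s) as i, (encode_seq (s ++ [k])) as j; intros i j H.
  rewrite !Cantor.to_nat_spec2.
  assert (E : (i + a) * S (i + a) <= (j + a) * S (j + a)) by (apply Nat.mul_le_mono; lia).
  apply (Nat.Div0.div_le_mono _ _ 2) in E; lia.
Qed.

(** After 4 n entries, the next four propose a bound for the node with code n only.
    As codes increase along prefixes, no bound has been proposed for the successors
    of that node, so that a newly admitted node is a successor of it. *)
Lemma obeys_extension u v s n :
  length u = 4 * n -> length v <= 4 -> obeys (u ++ v) s ->
  obeys u s \/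
  exists k, length v = 4 /\ s = decode_seq n ++ [k] /\ nth 3 v 0 <= k /\
            obeys u (decode_seq n).
Proof.
  intros Hu Hv; induction s as [|k s IH] using rev_ind; intro Hs;
    [left; apply steps_nil|].
  apply steps_snoc in Hs as [Hs [Hlen Hk]]; unfold slot in Hlen, Hk.
  rewrite length_app in Hlen.
  destruct (IH Hs) as [Ho|(k' & _ & -> & _)].
  - destruct (Nat.eq_dec (encode_seq s) n) as [<-|Hne].
    + right; exists k; rewrite decode_encode_seq.
      rewrite app_nth2 in Hk by lia.
      replace (4 * encode_seq s + 3 - length u) with 3 in Hk by lia.
      split; [lia | auto].
    + left; apply steps_snoc; split; [exact Ho|]; unfold slot.
      rewrite app_nth1 in Hk by lia; split; [lia | exact Hk].
  - pose proof (encode_snoc_gt (decode_seq n) k') as H.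
    rewrite encode_decode_seq in H; lia.
Qed.

(** A refuted attempt admits a covered node.  Otherwise consider the extensions of u
    by three zeros and a proposed bound m for the node with code n.  If for some m
    the node given by induction already obeys u, it will do.  If not, it is for
    every m a successor of node n beyond m; hence infinitely many successors of
    node n are secured, and node n obeys u.  The three zeros provide the stages. *)
Lemma attempt_secured x P u n :
  let r := attempt_order x in
  is_wellorder r -> secures x r P -> length u = 4 * n -> attempt x u ->
  exists s, obeys u s /\ P (encode_seq u) s.
Proof.
  intros r Hr HP; remember (encode_seq u) as c eqn:Ec; revert u n Ec.
  induction c as [c IH] using (well_founded_induction (wo_wf r Hr)).
  intros u n -> Hlen Hu.
  assert (Hrefuted : forall v, ~ attempt x v -> exists s, obeys v s /\ covered x s).
  { intros v Hv; apply NNPP; intro H; apply Hv; intros t k Ht Ek Ho; apply H.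
    exists (decode_seq k); split; [exact Ho|]; exists t, k, []; now rewrite app_nil_r. }
  assert (Hlt : forall v k, attempt x (v ++ [k]) ->
                  rlt r (encode_seq (v ++ [k])) (encode_seq v)).
  { intros v k Hv; split.
    - apply attempt_order_rle; rewrite !decode_encode_seq.
      split; [exact Hv|]; split; [now apply attempt_app in Hv|].
      clear; induction v as [|a v IHv]; [reflexivity | apply kb_cons; auto].
    - pose proof (encode_snoc_gt v k); lia. }
  destruct (classic (attempt x (((u ++ [0]) ++ [0]) ++ [0]))) as [H3|H3].
  2:{ destruct (Hrefuted _ H3) as (s & Ho & Hc); exists s; split; [|now apply HP; left].
      rewrite <- !app_assoc in Ho.
      destruct (obeys_extension u [0; 0; 0] s n Hlen (le_S 3 3 (le_n 3)) Ho) as [|(? & [=] & _)];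
        assumption. }
  pose proof (attempt_app _ _ _ H3) as H2; pose proof (attempt_app _ _ _ H2) as H1.
  apply Hlt in H1, H2; pose proof (Hlt _ _ H3) as Hlt3.
  set (u3 := ((u ++ [0]) ++ [0]) ++ [0]) in *.
  set (u2 := (u ++ [0]) ++ [0]) in *; set (u1 := u ++ [0]) in *.
  assert (Hchild : forall m, exists s, obeys (u3 ++ [m]) s /\ P (encode_seq u3) s).
  { intro m; destruct (classic (attempt x (u3 ++ [m]))) as [Hm|Hm].
    - pose proof (Hlt _ _ Hm) as Hlt4.
      destruct (IH (encode_seq (u3 ++ [m]))) with (u := u3 ++ [m]) (n := S n)
        as (s & Ho & Hs); auto.
      + apply (rlt_trans r _ (encode_seq u3) _ Hr Hlt4).
        apply (rlt_trans r _ (encode_seq u2) _ Hr Hlt3).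
        apply (rlt_trans r _ (encode_seq u1) _ Hr H2 H1).
      + unfold u3, u2, u1; rewrite !length_app, Hlen; cbn [length]; lia.
      + exists s; split; [exact Ho|].
        now apply (secures_mono x r P (encode_seq (u3 ++ [m]))).
    - destruct (Hrefuted _ Hm) as (s & Ho & Hc); exists s; split; [exact Ho|].
      apply HP; now left. }
  assert (Hup : forall s, P (encode_seq u3) s -> P (encode_seq u) s).
  { intros s Hs; apply (secures_mono x r P (encode_seq u3)); auto.
    apply (rlt_trans r _ (encode_seq u2) _ Hr Hlt3).
    apply (rlt_trans r _ (encode_seq u1) _ Hr H2 H1). }
  assert (Hchild' : forall m,
    (exists s, obeys u s /\ P (encode_seq u3) s) \/
    exists k, m <= k /\ obeys u (decode_seq n) /\ P (encode_seq u3) (decode_seq n ++ [k])).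
  { intro m; destruct (Hchild m) as (s & Ho & Hs).
    unfold u3, u2, u1 in Ho; rewrite <- !app_assoc in Ho.
    destruct (obeys_extension u [0; 0; 0; m] s n Hlen (le_n 4) Ho)
      as [Hos|(k & _ & -> & Hk & Hn)]; eauto. }
  destruct (classic (exists s, obeys u s /\ P (encode_seq u3) s)) as [(s & Ho & Hs)|Hno];
    [exists s; auto|].
  exists (decode_seq n); split.
  - destruct (Hchild' 0) as [H|(k & _ & H & _)]; [contradiction | exact H].
  - apply HP; right; exists (encode_seq u1), (encode_seq u2).
    split; [exact H1|]; split; [exact H2|]; intro b.
    destruct (Hchild' b) as [H|(k & Hk & _ & HPk)]; [contradiction|].
    exists (encode_seq u3), k; auto.
Qed.

Lemma root_secured x P :
  is_wellorder (attempt_order x) -> secures x (attempt_order x) P -> P 0 [].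
Proof.
  intros Hr HP.
  destruct (attempt_secured x P [] 0 Hr HP eq_refl) as (s & Ho & Hs).
  - intros t k Ht; cbn in Ht; lia.
  - destruct s as [|a s]; [exact Hs|].
    destruct (Ho [] a s eq_refl) as [H _]; cbn in H; lia.
Qed.

Lemma attempt_order_top x n :
  rdom (attempt_order x) 0 /\
  (rdom (attempt_order x) n -> n = 0 \/ rlt (attempt_order x) n 0).
Proof.
  assert (H0 : attempt x []) by (intros t k Ht; cbn in Ht; lia).
  unfold rlt; rewrite !attempt_order_rdom, attempt_order_rle; change (decode_seq 0) with (@nil nat).
  pose proof (kb_nil (decode_seq n)); destruct (Nat.eq_dec n 0); tauto.
Qed.

(** * The descent tree *)

(** Beyond an uncovered p the rank has to drop: some stage secures p ++ [a] but not
    yet p. *)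
Definition descent_tree (x r : baire) (P : nat -> list nat -> Prop) : list nat -> Prop :=
  steps (fun p a => covered x p \/ exists n, rdom r n /\ P n (p ++ [a]) /\ ~ P n p).

(** At the least stage that secures s, infinitely many successors are secured at
    stages that do not yet secure s. *)
Lemma descent_tree_laver x r P n :
  is_wellorder r -> secures x r P -> rdom r n -> P n [] ->
  laver_tree (descent_tree x r P).
Proof.
  intros Hr HP Hn Hroot; split; [|split].
  - intros s t; apply steps_app.
  - apply steps_nil.
  - intros s Hs b.
    assert (Hsec : exists m, rdom r m /\ P m s).
    { destruct s as [|a s _] using rev_ind; [now exists n|].
      apply steps_snoc in Hs as [_ [Hc|(m & Hm & HPm & _)]]; [|eauto].
      exists n; split; [exact Hn|]; apply HP; left; now apply covered_app. }
    destruct Hsec as (m & Hm & HPm).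
    destruct (exists_least r (fun m => P m s) m Hr Hm HPm) as (i & Hi & HPi & Hleast).
    apply HP in HPi as [Hc|(l & l' & Hl & Hl' & H)].
    + exists b; split; [lia|]; apply steps_snoc; auto.
    + destruct (H b) as (j & k & Hj & Hk & HPj).
      exists k; split; [exact Hk|]; apply steps_snoc; split; [exact Hs|]; right.
      exists j; split; [now apply (rlt_dom r j l')|]; split; [exact HPj|].
      apply Hleast, (rlt_trans r j l' i Hr Hj), (rlt_trans r l' l i Hr Hl' Hl).
Qed.

(** Along a branch that never meets a covered node the rank would decrease forever. *)
Lemma descent_tree_body x r P n g :
  is_wellorder r -> secures x r P -> rdom r n -> P n [] ->
  body (descent_tree x r P) g -> coded_open x g.
Proof.
  intros Hr HP Hn Hroot Hg.
  destruct (classic (exists i, covered x (restrict g i))) as [(i & t & k & q & Et & Ei)|Hno].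
  { exists t, k; split; [exact Et|]; exists (length (decode_seq k)).
    now apply restrict_prefix in Ei. }
  exfalso.
  assert (H : forall i, rdom r n -> ~ P n (restrict g i)).
  { clear Hn Hroot.
    induction n as [n IH] using (well_founded_induction (wo_wf r Hr)); intros i Hn HPi.
    specialize (Hg (S i)); rewrite restrict_S in Hg; apply steps_snoc in Hg as [_ Hg].
    destruct Hg as [Hc|(m & Hm & HPm & Hmi)]; [apply Hno; eauto|].
    rewrite <- restrict_S in HPm.
    destruct (rlt_total r m n Hr Hm Hn) as [Hlt|[->|Hlt]]; [|contradiction|].
    - now apply (IH m Hlt (S i)).
    - now apply Hmi, (secures_mono x r P n). }
  now apply (H 0).
Qed.

Lemma descent_tree_iso x (r r' : baire) h P P' :
  is_wellorder r -> is_wellorder r' ->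
  order_iso r r' h -> secures x r P -> secures x r' P' ->
  forall s, descent_tree x r P s <-> descent_tree x r' P' s.
Proof.
  intros Hr Hr' Hh HP HP'; pose proof (secures_iso x r r' h P P' Hr Hr' Hh HP HP') as H.
  destruct Hh as (Hdom & Honto & _).
  intro s; apply steps_ext; intros p a; apply or_iff_compat_l; split.
  - intros (n & Hn & H1 & H2); exists (h n).
    split; [auto|]; split; [now apply H | now rewrite <- H].
  - intros (m & Hm & H1 & H2); destruct (Honto m Hm) as (n & Hn & <-).
    exists n; split; [exact Hn|]; split; [now apply H | now rewrite H].
Qed.

(** With t the largest and z the least element of w, [D] at t tells whether a node
    is ever secured, and [D] at z whether it is covered.  The rank of p is the only
    stage that answers yes to [D] and no to [L], and so is found by a search; then
    [L] at that stage compares the rank of a successor with it. *)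
Lemma descent_tree_computable x (w : wellorder) P (D L : nat -> nat) t :
  (forall C F, computable C F -> computable C (fun x n => D (F x n))) ->
  (forall C F, computable C F -> computable C (fun x n => L (F x n))) ->
  (forall n s, jump_column x w n (D (encode_seq s)) = 1 <-> P n s) ->
  (forall n s, jump_column x w n (L (encode_seq s)) = 1 <-> exists j, rlt w j n /\ P j s) ->
  secures x w P ->
  rdom w t -> (forall n, rdom w n -> n = t \/ rlt w n t) ->
  turing_le (tree_char (descent_tree x w P)) (iter_jump x w).
Proof.
  intros HDc HLc HD HL HP Ht Htop; pose proof (wo_axioms w) as Hw.
  destruct (exists_least w (fun _ => True) t Hw Ht I) as (z & Hz & _ & Hzmin).
  assert (HaskD : forall n s, ask (iter_jump x w) n (D (encode_seq s)) = true <->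
                    rdom w n /\ P n s)
    by (intros; now rewrite ask_iter_jump, HD).
  assert (HaskL : forall n s, ask (iter_jump x w) n (L (encode_seq s)) = true <->
                    rdom w n /\ exists j, rlt w j n /\ P j s)
    by (intros; now rewrite ask_iter_jump, HL).
  set (O := iter_jump x w) in *.
  assert (Hz' : forall s, ask O z (D (encode_seq s)) = true <-> covered x s).
  { intro s; rewrite HaskD; split.
    - intros [_ H]; apply HP in H as [H|(l & _ & Hl & _)]; [exact H|].
      now apply Hzmin in Hl.
    - intro H; split; [exact Hz|]; apply HP; now left. }
  assert (Hup : forall n s, rdom w n -> P n s -> P t s).
  { intros n s Hn H; destruct (Htop n Hn) as [->|Hlt]; [exact H|].
    now apply (secures_mono x w P n). }
  (* The search stops at once on nodes that are never secured. *)
  destruct (computable_search (fun y => y = O)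
    (fun y c k => negb (ask y t (D c)) || ask y k (D c) && negb (ask y k (L c))))
    as (rho & Hrho & Hspec).
  { unfold ask; computability; (apply HDc || apply HLc); computability. }
  { intros y c ->; rewrite <- (encode_decode_seq c).
    destruct (ask O t _) eqn:E; [|now exists 0].
    apply HaskD in E as [_ E].
    destruct (exists_least w (fun n => P n (decode_seq c)) t Hw Ht E)
      as (k & Hk & HPk & Hmin).
    exists k; cbn [negb orb]; apply andb_true_iff; split; [now apply HaskD|].
    apply negb_true_iff, not_true_iff_false; rewrite HaskL.
    intros [_ (j & Hj & HPj)]; now apply (Hmin j). }
  pose (f y p a :=
    if ask y t (D (encode_seq p)) then
      ask y z (D (encode_seq p)) || ask y (rho y (encode_seq p)) (L (encode_seq (p ++ [a])))
    else ask y t (D (encode_seq (p ++ [a])))).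
  assert (Hf : forall p a, f O p a = true <->
    covered x p \/ exists n, rdom w n /\ P n (p ++ [a]) /\ ~ P n p).
  { intros p a; unfold f; specialize (Hspec O (encode_seq p) eq_refl).
    destruct (ask O t (D (encode_seq p))) eqn:E.
    - cbn [negb orb] in Hspec; apply andb_true_iff in Hspec as [H1 H2].
      apply negb_true_iff, not_true_iff_false in H2; rewrite HaskL in H2.
      apply HaskD in H1 as [Hr HPr]; set (r := rho O _) in *.
      rewrite orb_true_iff, Hz', HaskL; apply or_iff_compat_l; split.
      + intros [_ (j & Hj & HPj)]; exists j.
        split; [now apply (rlt_dom w j r)|]; split; [exact HPj|].
        intro; apply H2; eauto.
      + intros (n & Hn & HPn & Hno); split; [exact Hr|]; exists n; split; [|exact HPn].
        destruct (rlt_total w n r Hw Hn Hr) as [H|[->|H]]; [exact H|contradiction|].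
        now apply (secures_mono x w P r n) in HPr.
    - apply not_true_iff_false in E; rewrite HaskD in E; rewrite HaskD; split.
      + intros [_ H]; right; exists t; tauto.
      + intros [H|(n & Hn & H & _)]; [destruct E|]; (split; [exact Ht|]).
        * apply HP; now left.
        * now apply (Hup n). }
  assert (Hc : computable (fun y => y = O) (fun y n => Nat.b2n (stepsb (f y) (decode_seq n)))).
  { unfold stepsb, f, ask.
    apply computableb_forallb; [|computability].
    computability;
      repeat first [apply HDc | apply HLc | apply (computable_subst _ rho _ Hrho)
                   | progress computability]. }
  destruct Hc as [p Hp]; exists p; intro n; specialize (Hp O eq_refl n).
  replace (tree_char (descent_tree x w P) n) with (Nat.b2n (stepsb (f O) (decode_seq n)));
    [exact Hp|].
  assert (E : stepsb (f O) (decode_seq n) = true <-> descent_tree x w P (decode_seq n))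
    by (rewrite stepsb_spec; now apply steps_ext).
  unfold tree_char, char_fun; destruct excluded_middle_informative, (stepsb _ _);
    intuition discriminate.
Qed.

(** * The order types that bound the ranks *)

Definition order_type (r : baire) : omega1 :=
  exist _ (fun v : wellorder => same_type r v) (ex_intro _ r (fun v => iff_refl _)).

Definition attempt_wellorder (x : baire) (H : Acc (extends x) []) : wellorder :=
  {| wo_char := attempt_order x; wo_axioms := attempt_order_wellorder x H |}.

Lemma same_type_refl r : same_type r r.
Proof. exists (fun n => n); repeat split; eauto. Qed.

Theorem theorem1p10 :
  exists f : baire -> option omega1,
    partial_computable f /\
    forall x : baire,
      (exists T : list nat -> Prop,
         laver_tree T /\ (forall g, body T g -> coded_open x g)) ->
      exists b : omega1,
        f x = Some b /\
        exists T' : list nat -> Prop,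
          laver_tree T' /\
          turing_le_iter_jump (tree_char T') x b /\
          (forall g, body T' g -> coded_open x g).
Proof.
  destruct attempt_order_computable as [p Hp].
  assert (Hcomp : forall x, computes x p (attempt_order x)) by (intros x n; now apply Hp).
  exists (fun x =>
    match excluded_middle_informative (Acc (extends x) []) with
    | left H => Some (order_type (attempt_wellorder x H))
    | right _ => None
    end); split.
  { exists p; intros x b Hb; destruct excluded_middle_informative as [H|]; [|discriminate].
    injection Hb as <-; exists (attempt_wellorder x H).
    split; [apply Hcomp | apply same_type_refl]. }
  intros x (T & HT & Hopen).
  destruct excluded_middle_informative as [H|[]]; [|now apply (attempts_acc x T)].
  set (w0 := attempt_wellorder x H).
  exists (order_type w0); split; [reflexivity|].
  destruct secured_queries as (D & L & HD & HL & Hq).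
  pose (P (w : wellorder) n s := jump_column x w n (D (encode_seq s)) = 1).
  assert (HP : forall w : wellorder, secures x w (P w)) by (intro w; apply Hq).
  pose proof (wo_axioms w0) as Hw0.
  destruct (attempt_order_top x 0) as [Hdom0 _].
  assert (Hroot : P w0 0 []) by (apply (root_secured x); [exact Hw0 | apply HP]).
  exists (descent_tree x w0 (P w0)); split; [|split].
  - now apply (descent_tree_laver x w0 (P w0) 0).
  - split; [exists w0; split; [apply same_type_refl | now exists p]|].
    intros w Hw _; apply same_type_order_iso in Hw as [h Hh]; [|exact Hw0].
    replace (descent_tree x w0 (P w0)) with (descent_tree x w (P w)).
    + apply (descent_tree_computable x w (P w) D L (h 0)); auto.
      * intros; reflexivity.
      * apply Hq.
      * now apply (proj1 Hh).
      * intros m Hm; destruct Hh as (_ & Honto & Hlt), (Honto m Hm) as (n & Hn & <-).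
        destruct (proj2 (attempt_order_top x n) Hn) as [->|Hn0]; [now left | right].
        now apply Hlt.
    + apply functional_extensionality; intro s; apply propositional_extensionality.
      symmetry; apply (descent_tree_iso x w0 w h); auto; apply wo_axioms.
  - intro g; now apply (descent_tree_body x w0 (P w0) 0).
Qed.
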